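(* For every $v\ge 8$, there exists a $3$-way $3$-homogeneous $(v,3,2)$ Steiner trade of volume $v$, except for $v\in[10,15]\cup[19,23]\cup[28,31]\cup[37,39]\cup\{46,47,55\}$ (for which no such trade exists), where $[a,b]=\{c\in\mathbb{Z}: a\le c\le b\}$.
   Context: Let $V$ be a finite set with $v$ elements and let $t<k<v$ be positive integers. A $\mu$-way $(v,k,t)$ trade $T=\{T_1,\dots,T_\mu\}$ of volume $m$ consists of $\mu$ pairwise disjoint collections $T_1,\dots,T_\mu$, each of $m$ blocks ($k$-subsets of $V$), such that every $t$-subset of $V$ is contained in the same number of blocks in each $T_i$. The foundation $\mathrm{found}(T)$ is the set of elements covered by the blocks. It is a Steiner trade if every $t$-subset of $\mathrm{found}(T)$ is in at most one block of each $T_i$, and $d$-homogeneous if every element of $V$ lies in exactly $d$ blocks of each $T_i$. *)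

(* Defs.v *)
From mathcomp Require Import all_boot.

Set Implicit Arguments.
Unset Strict Implicit.
Unset Printing Implicit Defensive.

(* The parameter v of a (v,k,t) trade is #|V|.  Collections of blocks are sets:
   a Steiner trade has no repeated blocks, since t < k. *)
Definition mway_trade (V : finType) (mu k t m : nat)
    (T : 'I_mu -> {set {set V}}) : Prop :=
  [/\ 0 < t < k /\ k < #|V|,
      forall i, #|T i| = m,
      forall i (B : {set V}), B \in T i -> #|B| = k,
      forall i j, i != j -> [disjoint T i & T j]
    & forall S : {set V}, #|S| = t -> forall i j,
        #|[set B in T i | S \subset B]| = #|[set B in T j | S \subset B]|].

Definition found (V : finType) (mu : nat) (T : 'I_mu -> {set {set V}}) :
    {set V} :=
  \bigcup_i cover (T i).

Definition steiner (V : finType) (mu t : nat) (T : 'I_mu -> {set {set V}}) :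
    Prop :=
  forall S : {set V}, #|S| = t -> S \subset found T ->
    forall i, #|[set B in T i | S \subset B]| <= 1.

Definition homogeneous (V : finType) (mu d : nat)
    (T : 'I_mu -> {set {set V}}) : Prop :=
  forall (x : V) i, #|[set B in T i | x \in B]| = d.

(* Main.v *)
Require Import Defs.
From mathcomp Require Import all_boot.
From mathcomp Require Import zify.

Set Implicit Arguments.
Unset Strict Implicit.
Unset Printing Implicit Defensive.

(* Two points are adjacent when some block contains both; by balance this does
   not depend on the collection, and every point has six neighbours.  Such a
   trade is locally very rigid: starting from one point and repeatedly asking
   for the block of a given collection through a given adjacent pair, one meets
   a contradiction or closes up on 8 points (the affine plane of order 3 minus a
   point) or 9 points (a transversal design), after finitely many cases.  Hence
   V splits into parts of size 8 and 9, and conversely such parts can be glued;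
   the listed exceptions are the integers v >= 8 not of the form 8a + 9b. *)

(** * Case analysis on labelled blocks *)

(* States of the case analysis: the labels 0..n-1 stand for distinct points, and
   D lists the known blocks (i, B), with i the collection and B the labels of the
   three points. *)
Definition nbrs (D : seq (nat * seq nat)) (a : nat) : seq nat :=
  undup [seq b <- flatten [seq p.2 | p <- D & a \in p.2] | b != a].

(* Distinct blocks of one collection share at most one point, and no block lies
   in two collections; a count of 3 within one collection is a known block. *)
Definition compat (D : seq (nat * seq nat)) (i : nat) (B : seq nat) : bool :=
  [&& uniq B,
      all (fun p => count (mem p.2) B != (if p.1 == i then 2 else 3)) D
    & all (fun a => size (nbrs ((i, B) :: D) a) <= 6) B].

(* The first unused label, here c = n, stands for a point not met so far. *)
Definition completions n D i a b : seq (nat * seq nat) :=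
  [seq (i, B) | B <- [seq [:: a; b; c] | c <- iota 0 n.+1] & compat D i B].

(** Every neighbour of a point shares a block of collection 0 with it, so a missing one is sought
    there. If [b] is the new label [n], then [c] may be [n + 1]. *)
Definition extensions n D a : seq (nat * seq nat) :=
  [seq (0, B) | B <- [seq [:: a; b; c] |
                      b <- [seq b <- iota 0 n.+1 | b \notin nbrs D a],
                      c <- iota 0 (maxn n b.+1).+1] & compat D 0 B].

Definition uncovered n (D : seq (nat * seq nat)) : seq (nat * nat * nat) :=
  [seq t <- [seq (ab, i) | ab <- [seq (a, b) | a <- iota 0 n, b <- nbrs D a],
                           i <- iota 0 3]
     | ~~ has (fun p => [&& p.1 == t.2, t.1.1 \in p.2 & t.1.2 \in p.2]) D].

(** Blocks forced by balance come first; a point with fewer than six known neighbours is opened only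
    when none is pending. *)
Definition branching n D : option (seq (nat * seq nat)) :=
  if uncovered n D is (a, b, i) :: _ then Some (completions n D i a b) else
  if [seq a <- iota 0 n | size (nbrs D a) < 6] is a :: _
  then Some (extensions n D a) else None.

Definition saturated n D : bool :=
  (n \in [:: 8; 9]) && all (fun a => size (nbrs D a) == 6) (iota 0 n).

(** An empty list of branches is a contradiction and counts as success; [false] means lack of fuel
    or a closed configuration of the wrong size. *)
Fixpoint search fuel n D : bool :=
  if fuel is k.+1 then
    if saturated n D then true else
    if branching n D is Some s
    then all (fun p => search k (foldr maxn n (map S p.2)) (p :: D)) s
    else false
  else false.

(** * From labels to points *)

Definition im (V : finType) (f : nat -> V) (B : seq nat) : {set V} :=
  [set y in map f B].

Lemma im_mem (V : finType) (f : nat -> V) (B : seq nat) y :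
  (y \in im f B) = (y \in map f B).
Proof. by rewrite /im inE. Qed.

Lemma im_f (V : finType) (f : nat -> V) (B : seq nat) a :
  a \in B -> f a \in im f B.
Proof. by move=> aB; rewrite im_mem map_f. Qed.

Lemma card_imI (V : finType) (f : nat -> V) n (B C : seq nat) :
  {in gtn n &, injective f} -> all (gtn n) B -> all (gtn n) C -> uniq B ->
  #|im f B :&: im f C| = count (mem C) B.
Proof.
move=> fI /allP Bn /allP Cn uB.
have -> : im f B :&: im f C = [set y in map f (filter (mem C) B)].
  apply/setP=> y; rewrite in_setI !im_mem.
  apply/andP/mapP=> [[/mapP[a aB ->] /mapP[c cC eac]]|[a]].
    by exists a => //; rewrite mem_filter aB (fI _ _ (Bn _ aB) (Cn _ cC) eac) /= cC.
  by rewrite mem_filter => /andP[/= aC aB] ->; rewrite !map_f.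
rewrite cardsE -size_filter -(size_map f); apply/card_uniqP.
rewrite map_inj_in_uniq ?filter_uniq // => a b.
by rewrite !mem_filter => /andP[_ /Bn an] /andP[_ /Bn bn]; apply: fI.
Qed.

Lemma mem_nbrs (D : seq (nat * seq nat)) a b :
  reflect (b != a /\ exists2 p, p \in D & (a \in p.2) && (b \in p.2))
          (b \in nbrs D a).
Proof.
rewrite mem_undup mem_filter; apply: (iffP andP) => -[ba].
  case/flattenP=> s /mapP[p]; rewrite mem_filter => /andP[ap pD] -> bp.
  by split=> //; exists p => //; rewrite ap.
case=> p pD /andP[ap bp]; split=> //; apply/flattenP; exists p.2 => //.
by apply/mapP; exists p => //; rewrite mem_filter ap.
Qed.

(** * Soundness of the search *)

Section Soundness.

Variables (V : finType) (T : nat -> {set {set V}}).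

Definition nbhd (x : V) : {set V} :=
  [set y | (y != x) && [exists B in T 0, (x \in B) && (y \in B)]].

(** These are the unions of connected components of the adjacency graph. *)
Definition closed_set (A : {set V}) : Prop := {in A, forall x, nbhd x \subset A}.

Definition realizes (f : nat -> V) n (D : seq (nat * seq nat)) (A : {set V}) :=
  [/\ {in gtn n &, injective f},
      forall a, a < n -> f a \in A
    & forall p, p \in D -> [/\ p.1 < 3, all (gtn n) p.2 & im f p.2 \in T p.1]].

Hypothesis card_block : forall i B, i < 3 -> B \in T i -> #|B| = 3.
Hypothesis T_disj : forall i j B, i < 3 -> j < 3 -> B \in T i -> B \in T j -> i = j.
(** Equal blocks meet in 3 points, distinct ones in at most one. *)
Hypothesis T_steiner : forall i B C,
  i < 3 -> B \in T i -> C \in T i -> #|B :&: C| != 2.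
Hypothesis T_balanced : forall i j B x y, i < 3 -> j < 3 -> x != y ->
  B \in T i -> x \in B -> y \in B -> exists2 C, C \in T j & (x \in C) && (y \in C).
Hypothesis card_nbhd : forall x, #|nbhd x| = 6.

Lemma mem_nbhd i B x y :
  i < 3 -> B \in T i -> x \in B -> y \in B -> y != x -> y \in nbhd x.
Proof.
move=> i3 BT xB yB yx; rewrite inE yx /=.
rewrite eq_sym in yx; have [C CT C2] := T_balanced (j := 0) i3 isT yx BT xB yB.
by apply/existsP; exists C; rewrite CT.
Qed.

Lemma realizes_label f n D A y : realizes f n D A -> y \in A ->
  exists f' b, [/\ b <= n, f' b = y, realizes f' (maxn n b.+1) D A
                 & {in gtn n, f' =1 f}].
Proof.
case=> fI fA fD yA.
have [/hasP[b]|/hasPn ny] := boolP (has (fun b => f b == y) (iota 0 n)).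
  rewrite mem_iota /= add0n => bn /eqP fb.
  exists f, b; split=> //; first exact: ltnW.
  by rewrite (maxn_idPl bn).
have {}ny b : b < n -> f b != y by move=> bn; apply: ny; rewrite mem_iota.
exists (fun a => if a == n then y else f a), n.
have En a : a < n -> (if a == n then y else f a) = f a.
  by move=> an; rewrite ltn_eqF.
have -> : maxn n n.+1 = n.+1 by lia.
split=> //; rewrite ?eqxx //; split.
- move=> a b; rewrite !inE !ltnS => an bn.
  case: (altP (a =P n)) => [->|a_n]; case: (altP (b =P n)) => [->|b_n] //.
  + move=> /esym/eqP; rewrite (negPf (ny _ _)) //; lia.
  + move=> /eqP; rewrite (negPf (ny _ _)) //; lia.
  by apply: fI; rewrite inE; lia.
- by move=> a an; case: eqP => // a_n; apply: fA; lia.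
- move=> p /fD[i3 pn pT]; split=> //.
    by apply: sub_all pn => a /=; lia.
  rewrite /im (_ : map _ p.2 = map f p.2) //.
  by apply/eq_in_map => a /(allP pn); exact: En.
Qed.

Lemma size_nbrs f n D A a : realizes f n D A ->
  a < n -> map f (nbrs D a) \subset nbhd (f a)
           /\ #|map f (nbrs D a)| = size (nbrs D a).
Proof.
case=> fI fA fD an.
have Dn b p : p \in D -> b \in p.2 -> b < n.
  by case/fD=> _ /allP pn _ /pn.
split.
  apply/subsetP=> _ /mapP[b /mem_nbrs[ba [p pD /andP[ap bp]]] ->].
  have [i3 _ pT] := fD p pD.
  apply: (mem_nbhd i3 pT); rewrite ?im_f //.
  by apply: contra ba => /eqP/fI ->; rewrite ?inE ?(Dn _ p).
rewrite -(size_map f); apply/card_uniqP.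
rewrite map_inj_in_uniq; first exact: undup_uniq.
move=> b c; case/mem_nbrs=> _ [p pD /andP[_ bp]] /mem_nbrs[_ [q qD /andP[_ cq]]].
by apply: fI; [apply: Dn pD bp|apply: Dn qD cq].
Qed.

(** Each test of [compat] reflects a property of the trade, so pruning by it discards no actual
    configuration. *)
Lemma realizes_cons f n D A i B : realizes f n D A -> i < 3 ->
  all (gtn n) B -> size B = 3 -> im f B \in T i ->
  realizes f n ((i, B) :: D) A /\ compat D i B.
Proof.
move=> rf i3 Bn B3 BT; have [fI fA fD] := rf.
have rf' : realizes f n ((i, B) :: D) A.
  by split=> // p; rewrite inE => /predU1P[->|/fD].
split=> //.
have uB : uniq B.
  apply: (@map_uniq _ _ f); apply/card_uniqP.
  by rewrite size_map B3 -(card_block i3 BT) cardsE.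
rewrite /compat uB /=; apply/andP; split; apply/allP; last first.
  move=> a aB; have [sub <-] := size_nbrs rf' (allP Bn a aB).
  by rewrite -(card_nbhd (f a)) subset_leq_card.
case=> j C pD; have [j3 Cn CT] := fD _ pD; rewrite /= in j3 Cn CT *.
rewrite -(card_imI fI) //; case: (altP (j =P i)) => [ji|ji].
  by apply: (T_steiner i3) => //; rewrite -ji.
(* A count of 3 makes the two blocks equal, against the disjointness of distinct collections. *)
apply: contra ji => /eqP BC3; apply/eqP.
apply: (T_disj j3 i3 CT); suff <- : im f B = im f C by [].
apply/eqP; rewrite eqEcard (card_block j3 CT) -BC3 subset_leq_card ?subsetIl //.
rewrite andbT; apply/setIidPl/eqP.
by rewrite eqEcard subsetIl BC3 (card_block i3 BT).
Qed.

Lemma third_point i B x y : i < 3 -> B \in T i -> x \in B -> y \in B -> x != y ->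
  exists z, B = [set x; y; z].
Proof.
move=> i3 BT xB yB xy.
have : #|B :\ x :\ y| = 1.
  have := card_block i3 BT; rewrite (cardsD1 x) xB (cardsD1 y) !inE eq_sym xy yB /=.
  lia.
case/eqP/cards1P=> z Ez; exists z.
by rewrite -setUA -Ez !setD1K // !inE eq_sym xy.
Qed.

Lemma im3 f a b c : im f [:: a; b; c] = [set f a; f b; f c] :> {set V}.
Proof. by apply/setP=> y; rewrite !inE orbA. Qed.

Lemma block_sub A i B x : closed_set A -> i < 3 -> B \in T i ->
  x \in B -> x \in A -> B \subset A.
Proof.
move=> cA i3 BT xB xA; apply/subsetP=> y yB.
have [->|yx] := eqVneq y x; first by [].
by apply: (subsetP (cA x xA)); exact: mem_nbhd i3 BT _ _ yx.
Qed.

(** Balance supplies a block through an uncovered pair, and the degree six a block towards a missing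
    neighbour; closedness keeps its points in [A]. So the branches are exhaustive. *)
Lemma branchingP f n D A s : closed_set A -> realizes f n D A ->
  branching n D = Some s ->
  exists f' p, [/\ p \in s
    & realizes f' (foldr maxn n (map S p.2)) (p :: D) A].
Proof.
move=> cA rf; have [fI fA fD] := rf.
rewrite /branching; case Eu: (uncovered n D) => [|[[a b] i] u].
  case Ed: [seq _ <- _ | _] => [//|a d] [<-] {s}.
  have : a \in [seq a <- iota 0 n | size (nbrs D a) < 6] by rewrite Ed mem_head.
  rewrite mem_filter mem_iota add0n => /and3P[dega _ an] {Eu Ed d}.
  have [sub Ecard] := size_nbrs rf an.
  (* Fewer than six of the six neighbours are known. *)
  have /subsetPn[y] : ~~ (nbhd (f a) \subset map f (nbrs D a)).
    by apply/negP=> /subset_leq_card; rewrite card_nbhd Ecard; lia.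
  move=> yN yn; have yA : y \in A by apply: (subsetP (cA _ (fA _ an))).
  move: yN; rewrite inE => /andP[ya /existsP[B /and3P[BT aB yB]]].
  rewrite eq_sym in ya; have [z EB] := third_point (i := 0) isT BT aB yB ya.
  have zA : z \in A.
    apply: (subsetP (block_sub (i := 0) cA isT BT aB (fA _ an))) => //.
    by rewrite EB !inE eqxx orbT.
  have [g [b [bn gb rg gf]]] := realizes_label rf yA.
  have [h [c [cn hc rh hg]]] := realizes_label rg zA.
  have ha : h a = f a by rewrite hg ?gf // inE leq_max an.
  have hb : h b = y by rewrite hg ?gb // inE leq_max ltnSn orbT.
  exists h, (0, [:: a; b; c]).
  have -> : foldr maxn n (map S (0, [:: a; b; c]).2) = maxn (maxn n b.+1) c.+1.
    by move: an; clear; rewrite /=; lia.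
  have [||||] := realizes_cons (i := 0) (B := [:: a; b; c]) rh => //.
  - by move: an; clear; rewrite /=; lia.
  - by rewrite im3 ha hb hc -EB.
  move=> rh' cmp; split=> //; apply: map_f; rewrite mem_filter cmp andTb.
  apply/allpairsPdep; exists b, c; split=> //; last first.
    by move: cn; clear; rewrite mem_iota; lia.
  rewrite mem_filter mem_iota leq0n ltnS bn !andbT.
  apply: contra yn => bN; rewrite -gb gf; first exact: map_f.
  by case/mem_nbrs: bN => _ [p /fD[_ /allP pn _] /andP[_ /pn]].
move=> [<-] {s}.
have : (a, b, i) \in uncovered n D by rewrite Eu mem_head.
rewrite mem_filter => /andP[_ /allpairsPdep[ab [j [abP jP E]]]] {Eu u}.
case: E abP jP => <- <- /allpairsPdep[a' [b' [aP bP E]]] {ab j}.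
case: E aP bP => <- <- {a' b'}.
rewrite !mem_iota => /= an /mem_nbrs[ba [p pD /andP[ap bp]]] i3.
have [j3 /allP pn pT] := fD p pD; have bn : b < n by apply: pn.
have ab : f a != f b by apply: contra ba => /eqP/fI ->; rewrite ?inE.
have [B BT /andP[aB bB]] := T_balanced j3 i3 ab pT (im_f f ap) (im_f f bp).
have [z EB] := third_point i3 BT aB bB ab.
have zA : z \in A.
  apply: (subsetP (block_sub cA i3 BT aB (fA _ an))) => //.
  by rewrite EB !inE eqxx orbT.
have [h [c [cn hc rh hf]]] := realizes_label rf zA.
exists h, (i, [:: a; b; c]).
have -> : foldr maxn n (map S (i, [:: a; b; c]).2) = maxn n c.+1.
  by move: an bn; clear; rewrite /=; lia.
have [||||] := realizes_cons (i := i) (B := [:: a; b; c]) rh => //.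
- by move: an bn; clear; rewrite /=; lia.
- by rewrite im3 hc !hf ?inE // -EB.
move=> rh' cmp; split=> //; apply: map_f; rewrite mem_filter cmp andTb.
by apply: map_f; rewrite mem_iota.
Qed.

(** Six known neighbours are all the neighbours, so the labelled points are closed under
    adjacency. *)
Lemma saturated_closed f n D A : realizes f n D A -> saturated n D ->
  exists C : {set V}, [/\ C \subset A, closed_set C & #|C| \in [:: 8; 9]].
Proof.
move=> rf /andP[n89 /allP deg6]; have [fI fA fD] := rf.
exists (im f (iota 0 n)); split.
- by apply/subsetP=> y; rewrite im_mem => /mapP[a]; rewrite mem_iota => /fA ? ->.
- move=> x; rewrite im_mem => /mapP[a aI ->].
  have an : a < n by move: aI; rewrite mem_iota.
  have [sub Ecard] := size_nbrs rf an.
  have /subset_leqif_cards : [set y in map f (nbrs D a)] \subset nbhd (f a).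
    by apply/subsetP=> y; rewrite inE; apply: (subsetP sub).
  rewrite cardsE Ecard card_nbhd (eqP (deg6 a aI)) => -[_ /esym/eqP <-].
  apply/subsetP=> y; rewrite im_mem inE => /mapP[b /mem_nbrs[_ [p pD /andP[_ bp]]] ->].
  by have [_ /allP pn _] := fD p pD; rewrite map_f ?mem_iota //; apply: pn.
- suff -> : #|im f (iota 0 n)| = n by [].
  rewrite cardsE -[RHS](size_iota 0) -(size_map f); apply/card_uniqP.
  rewrite map_inj_in_uniq ?iota_uniq // => a b.
  by rewrite !mem_iota; apply: fI.
Qed.

(** The actual trade follows some branch at every level, hence never meets an empty list of branches
    and must end in a saturated state. *)
Lemma search_sound k f n D A : search k n D -> closed_set A -> realizes f n D A ->
  exists C : {set V}, [/\ C \subset A, closed_set C & #|C| \in [:: 8; 9]].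
Proof.
move=> + cA; elim: k f n D => [//|k IHk] f n D /=.
case: ifP => [sat _ rf|_]; first exact: saturated_closed rf sat.
case Eb: branching => [s|//] /allP sk rf.
have [f' [p [ps rf']]] := branchingP cA rf Eb.
exact: IHk (sk p ps) rf'.
Qed.

(** The search starts from one point and no block. Each level adds a block, so fuel 25 allows up to
    24 blocks. *)
Lemma search_true : search 25 1 [::].
Proof. by vm_cast_no_check (erefl true). Qed.

Lemma card_closed_set A : closed_set A -> exists a b, #|A| = 8 * a + 9 * b.
Proof.
have [m] := ubnP #|A|; elim: m A => // m IHm A Am cA.
have [->|[x xA]] := set_0Vmem A; first by exists 0, 0; rewrite cards0.
have rx : realizes (fun _ => x) 1 [::] A.
  by split=> // a b; rewrite !inE !ltnS !leqn0 => /eqP-> /eqP->.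
have [C [CA cC C89]] := search_sound search_true cA rx.
have EA : #|A| = #|C| + #|A :\: C| by rewrite -(cardsID C A) (setIidPr CA).
have [||a [b E]] := IHm (A :\: C).
- by move: C89; rewrite !inE; lia.
(* Adjacency is symmetric, so removing a closed set leaves a closed set. *)
- move=> y; rewrite inE => /andP[yC yA]; apply/subsetP=> z zy.
  rewrite inE (subsetP (cA y yA)) // andbT; apply: contra yC => zC.
  apply: (subsetP (cC z zC)); move: zy; rewrite !inE eq_sym => /andP[-> /=].
  by under eq_existsb do rewrite [(y \in _) && _]andbC.
move: C89; rewrite !inE EA E => /orP[]/eqP->; [exists a.+1, b|exists a, b.+1]; lia.
Qed.

End Soundness.

(** * Gluing trades on disjoint point sets *)

Section PartialTrades.

Variable V : finType.

(** All parts live in the same type [V], so gluing is a union. The empty set qualifies, as base of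
    the induction; the volume is recovered later by counting. *)
Definition trade_on (A : {set V}) (T : 'I_3 -> {set {set V}}) : Prop :=
  [/\ forall i B, B \in T i -> B \subset A /\ #|B| = 3,
      forall i j, i != j -> [disjoint T i & T j],
      forall S : {set V}, #|S| = 2 -> forall i j,
        #|[set B in T i | S \subset B]| = #|[set B in T j | S \subset B]|,
      forall S : {set V}, #|S| = 2 -> forall i,
        #|[set B in T i | S \subset B]| <= 1
    & {in A, forall x i, #|[set B in T i | x \in B]| = 3}].

Lemma trade_on_eq0 A T i (P : pred {set V}) : trade_on A T ->
  (forall B : {set V}, B \subset A -> ~~ P B) -> #|[set B in T i | P B]| = 0.
Proof.
case=> TA _ _ _ _ nP; apply/eqP; rewrite cards_eq0 -subset0.
by apply/subsetP=> B; rewrite !inE => /andP[/TA[/nP/negPf ->]].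
Qed.

(** Only the empty set lies in both [A] and [A'], so no block is shared, and a pair or a point is
    covered from at most one side. *)
Lemma trade_on_setU (A A' : {set V}) T T' : [disjoint A & A'] ->
  trade_on A T -> trade_on A' T' -> trade_on (A :|: A') (fun i => T i :|: T' i).
Proof.
move=> dA tT tT'; have [TA Td Tb Ts Th] := tT; have [TA' Td' Tb' Ts' Th'] := tT'.
have dTT' i j : [disjoint T i & T' j].
  rewrite disjoint_subset; apply/subsetP=> B /TA[BA B3]; rewrite inE.
  apply/negP=> /TA'[BA' _].
  have : B \subset A :&: A' by rewrite subsetI BA.
  by move: dA; rewrite -setI_eq0 => /eqP->; rewrite subset0 -cards_eq0 B3.
have cardU (P : pred {set V}) i : #|[set B in T i :|: T' i | P B]|
    = #|[set B in T i | P B]| + #|[set B in T' i | P B]|.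
  have -> : [set B in T i :|: T' i | P B]
      = [set B in T i | P B] :|: [set B in T' i | P B].
    by apply/setP=> B; rewrite !inE andb_orl.
  apply/eqP; rewrite -cardsUI eq_sym -[X in _ == X]addn0 eqn_add2l cards_eq0.
  rewrite -subset0; apply/subsetP=> B; rewrite !inE => /andP[/andP[BT _]].
  by rewrite (disjointFr (dTT' i i) BT).
split.
- move=> i B; rewrite inE => /orP[/TA|/TA'] [BA ->]; split=> //.
    by rewrite subsetU ?BA.
  by rewrite subsetU ?BA ?orbT.
- move=> i j ij; rewrite -setI_eq0 setIUl !setIUr [T' i :&: T j]setIC.
  by rewrite !disjoint_setI0 ?Td ?Td' ?dTT' // !setU0.
- by move=> S S2 i j; rewrite !cardU (Tb S S2 i j) (Tb' S S2 i j).
- move=> S S2 i; rewrite cardU.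
  have [SA|SA] := boolP (S \subset A); last first.
    rewrite (trade_on_eq0 _ tT) ?Ts' // => B BA.
    by apply: contra SA => /subset_trans; apply.
  rewrite [X in _ + X](trade_on_eq0 _ tT') ?addn0 ?Ts // => B BA'.
  apply/negP=> /subset_trans/(_ BA') SA'.
  have : S \subset A :&: A' by rewrite subsetI SA.
  by move: dA; rewrite -setI_eq0 => /eqP->; rewrite subset0 -cards_eq0 S2.
- move=> x; rewrite inE => /orP[] xA i; rewrite cardU.
    rewrite Th // (trade_on_eq0 _ tT') // => B BA'.
    by apply: contraFN (disjointFr dA xA) => /(subsetP BA').
  rewrite Th' // (trade_on_eq0 _ tT) // => B BA.
  by apply: contraFN (disjointFl dA xA) => /(subsetP BA).
Qed.

(** * Explicit trades on 8 and 9 points *)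

(** Blocks are sorted lists, so that equality of lists is equality of sets. The pair test combines
    balance with the Steiner bound. *)
Definition design_check n (L : nat -> seq (seq nat)) : bool :=
  [&& all (fun i => uniq (L i) &&
        all (fun B => [&& sorted ltn B, size B == 3 & all (gtn n) B]) (L i))
        (iota 0 3),
      all (fun i => all (fun j => (i == j) || ~~ has (mem (L i)) (L j)) (iota 0 3))
        (iota 0 3),
      all (fun a => all (fun b => (a == b) ||
        let m i := count (fun B : seq nat => (a \in B) && (b \in B)) (L i) in
        [&& m 0 <= 1, m 1 == m 0 & m 2 == m 0]) (iota 0 n)) (iota 0 n)
    & all (fun a => all (fun i => count (fun B : seq nat => a \in B) (L i) == 3)
        (iota 0 3)) (iota 0 n)].

Lemma trade_on_design (A : {set V}) (f : nat -> V) n L :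
  {in gtn n &, injective f} -> im f (iota 0 n) = A -> design_check n L ->
  trade_on A (fun i => [set B in map (im f) (L i)]).
Proof.
move=> fI <-; case/and4P=> [/allP wf /allP dj /allP pr /allP hom].
have iI (i : 'I_3) : val i \in iota 0 3 by rewrite mem_iota ltn_ord.
have Lu (i : 'I_3) : uniq (L i) by have /andP[] := wf _ (iI i).
have Lwf (i : 'I_3) B : B \in L i -> [/\ sorted ltn B, size B = 3 & all (gtn n) B].
  by have /andP[_ /allP w] := wf _ (iI i) => /w/and3P[? /eqP].
have mem_im B a : all (gtn n) B -> a < n -> (f a \in im f B) = (a \in B).
  move=> /allP Bn an; rewrite im_mem; apply/mapP/idP=> [[b bB /fI ->]|aB] //.
    exact: Bn.
  by exists a.
have imI i j B C : B \in L (i : 'I_3) -> C \in L (j : 'I_3) -> im f B = im f C -> B = C.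
  move=> /Lwf[sB _ Bn] /Lwf[sC _ Cn] E.
  apply: (irr_sorted_eq ltn_trans ltnn) => // a.
  have [an|na] := ltnP a n; first by rewrite -!mem_im // E.
  by apply/idP/idP=> [/(allP Bn)|/(allP Cn)] /=; rewrite ltnNge na.
have cardL (P : pred {set V}) (i : 'I_3) :
    #|[set B in [set B in map (im f) (L i)] | P B]| = count (P \o im f) (L i).
  have -> : [set B in [set B in map (im f) (L i)] | P B]
      = [set B in map (im f) (filter (P \o im f) (L i))].
    apply/setP=> B; rewrite !inE; apply/andP/mapP=> [[/mapP[C CL ->] PC]|[C]].
      by exists C; rewrite // mem_filter /= PC.
    by rewrite mem_filter => /andP[/= PC CL] ->; rewrite map_f.
  rewrite cardsE -size_filter -(size_map (im f)); apply/card_uniqP.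
  rewrite map_inj_in_uniq ?filter_uniq // => B C.
  by rewrite !mem_filter => /andP[_ BL] /andP[_ CL]; apply: imI BL CL.
(* One [m] for all collections yields both balance and the Steiner bound; it is 0 for pairs not
   inside [A]. *)
have card_pair (S : {set V}) : #|S| = 2 ->
    exists2 m, m <= 1 & forall i : 'I_3, count (fun B => S \subset im f B) (L i) = m.
  move=> S2; have [SA|SA] := boolP (S \subset im f (iota 0 n)); last first.
    exists 0 => // i; apply/eqP; rewrite -leqn0 leqNgt -has_count.
    apply/hasPn=> B /Lwf[_ _ /allP Bn]; apply: contra SA => /subset_trans; apply.
    apply/subsetP=> y; rewrite !im_mem => /mapP[b /Bn bn ->].
    by rewrite map_f // mem_iota.
  have /cards2P[x [y [xy ES]]] : #|S| == 2 by rewrite S2.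
  have : y \in im f (iota 0 n) by apply: (subsetP SA); rewrite ES !inE eqxx orbT.
  have : x \in im f (iota 0 n) by apply: (subsetP SA); rewrite ES !inE eqxx.
  rewrite !im_mem => /mapP[a aI Ex] /mapP[b bI Ey].
  have /allP/(_ b bI) := pr a aI.
  have /negPf -> /= : a != b by apply: contra xy => /eqP ab; rewrite Ex Ey ab.
  case/and3P=> m1 /eqP E1 /eqP E2; eexists; first exact: m1.
  move=> i.
  rewrite -[RHS](_ : count (fun B : seq nat => (a \in B) && (b \in B)) (L i) = _).
    apply: eq_in_count => B /Lwf[_ _ Bn].
    move: aI bI; rewrite !mem_iota => an bn.
    by rewrite ES subUset !sub1set Ex Ey !mem_im.
  by case: i => [[|[|[|//]]] i3].
split.
- move=> i B; rewrite inE => /mapP[C /Lwf[sC C3 Cn] ->]; split.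
    apply/subsetP=> y; rewrite !im_mem => /mapP[b /(allP Cn) bn ->].
    by rewrite map_f // mem_iota.
  rewrite cardsE -C3 -(size_map f); apply/card_uniqP.
  rewrite map_inj_in_uniq ?(sorted_uniq ltn_trans ltnn) // => a b /(allP Cn) an.
  by move=> /(allP Cn); apply: fI.
- move=> i j ij; rewrite disjoint_subset; apply/subsetP=> B.
  rewrite !inE => /mapP[C CL ->]; apply/negP=> /mapP[D DL /(imI _ _ _ _ CL DL) E].
  have /allP/(_ _ (iI j)) := dj _ (iI i); rewrite val_eqE (negPf ij) /= => /hasPn.
  by move=> /(_ D DL); rewrite /= -E CL.
- by move=> S /card_pair[m _ Em] i j; rewrite !cardL /comp !Em.
- by move=> S /card_pair[m m1 Em] i; rewrite cardL /comp Em.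
- move=> x; rewrite im_mem => /mapP[a aI ->] i; rewrite cardL.
  have /allP/(_ _ (iI i))/eqP E := hom a aI; rewrite -[RHS]E.
  apply: eq_in_count => B /Lwf[_ _ Bn].
  by rewrite /= mem_im //; move: aI; rewrite mem_iota.
Qed.

(* Three decompositions of the pairs of Z/8 whose difference is not 4: the
   orbits of {0,1,3} and {0,2,3}, and the orbits of {0,1,2} and {1,4,7}
   under even translations. *)
Definition design8 (i : nat) : seq (seq nat) :=
  map (fun B => sort leq (map (modn^~ 8) B))
    (match i with
     | 0 => [seq [:: x; x + 1; x + 3] | x <- iota 0 8]
     | 1 => [seq [:: x; x + 2; x + 3] | x <- iota 0 8]
     | _ => [seq [:: x; x + 1; x + 2] | x <- [:: 0; 2; 4; 6]]
            ++ [seq [:: x + 1; x + 4; x + 7] | x <- [:: 0; 2; 4; 6]]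
     end).

(* The lines z = x + y + i, as transversals of three groups of size 3. *)
Definition design9 (i : nat) : seq (seq nat) :=
  [seq [:: x; 3 + y; 6 + (x + y + i) %% 3] | x <- iota 0 3, y <- iota 0 3].

Lemma trade_on_small (A : {set V}) : #|A| \in [:: 8; 9] -> exists T, trade_on A T.
Proof.
(* [x0] only serves as default value of [nth]. *)
move=> A89; have [x0 _] : exists x, x \in A.
  by apply/card_gt0P; move: A89; rewrite !inE => /orP[]/eqP->.
have EA : im (nth x0 (enum A)) (iota 0 #|A|) = A.
  apply/setP=> x; rewrite im_mem cardE -[map _ _]/(mkseq _ _) mkseq_nth.
  by rewrite mem_enum.
have nI : {in gtn #|A| &, injective (nth x0 (enum A))}.
  move=> a b; rewrite !inE cardE => an bn /eqP.
  by rewrite nth_uniq ?enum_uniq // => /eqP.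
have [L cL] : exists L, design_check #|A| L.
  by move: A89; rewrite !inE => /orP[]/eqP->; [exists design8|exists design9].
by eexists; apply: trade_on_design nI EA cL.
Qed.

Lemma trade_on_add (A : {set V}) n m : #|A| = n + m -> n \in [:: 8; 9] ->
  (forall A' : {set V}, #|A'| = m -> exists T, trade_on A' T) ->
  exists T, trade_on A T.
Proof.
move=> EA n89 IH; pose C := [set x in take n (enum A)].
have CA : C \subset A.
  by apply/subsetP=> x; rewrite inE => /mem_take; rewrite mem_enum.
have nC : #|C| = n.
  rewrite cardsE (card_uniqP _) ?take_uniq ?enum_uniq // size_takel //.
  by rewrite -cardE EA leq_addr.
have [T tT] : exists T, trade_on C T by apply: trade_on_small; rewrite nC.
have [|T' tT'] := IH (A :\: C); first by rewrite cardsDS // EA nC addKn.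
exists (fun i => T i :|: T' i); rewrite -(setID A C) (setIidPr CA).
apply: trade_on_setU => //; rewrite -setI_eq0 setIDA setIC.
by rewrite -setIDA setDv setI0.
Qed.

Lemma trade_on_exists a b (A : {set V}) :
  #|A| = 8 * a + 9 * b -> exists T, trade_on A T.
Proof.
elim: a b A => [|a IHa] b A; last first.
  by rewrite mulnS -addnA => /trade_on_add; apply=> // A'; apply: IHa.
elim: b A => [|b IHb] A; last first.
  by rewrite mulnS addnCA => /trade_on_add; apply.
move=> /eqP; rewrite cards_eq0 => /eqP->; exists (fun=> set0); split.
- by move=> i B; rewrite inE.
- by move=> i j _; rewrite disjoints_subset sub0set.
- by [].
- move=> S _ i; rewrite (_ : [set _ in _ | _] = set0) ?cards0 //.
  by apply/setP=> B; rewrite !inE.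
- by move=> x; rewrite inE.
Qed.

End PartialTrades.

(** * Double counting, the exceptional values, and the equivalence *)

(** Double counting of incidences; it gives the volume with [A] the whole set, and the degree six
    with [A] the complement of a point. *)
Lemma sum_card_blocks (V : finType) (F : {set {set V}}) (A : {set V}) :
  \sum_(B in F) #|B :&: A| = \sum_(y in A) #|[set B in F | y \in B]|.
Proof.
under eq_bigr => B _ do rewrite -sum1_card.
rewrite (exchange_big_dep (mem A)) /=; last by move=> B y _ /setIP[].
apply: eq_bigr => y yA; rewrite -sum1_card.
by apply: eq_bigl => B; rewrite !inE yA andbT.
Qed.

Lemma semigroup89P v : 8 <= v ->
  reflect (exists a b, v = 8 * a + 9 * b)
   (~~ [|| 10 <= v <= 15, 19 <= v <= 23, 28 <= v <= 31, 37 <= v <= 39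
           | v \in [:: 46; 47; 55]]).
Proof.
move=> v8; rewrite !inE; apply: (iffP idP) => [vP|[a [b ->]]]; last by lia.
(* With [v = 8q + r], one has [v = 8(q - r) + 9r]; the exceptions are exactly the cases [r > q]. *)
by exists (v %/ 8 - v %% 8), (v %% 8); lia.
Qed.

Theorem theorem2p8 (v : nat) (V : finType) (hV : #|V| = v) (hv : 8 <= v) :
  (exists T : 'I_3 -> {set {set V}},
     [/\ mway_trade 3 2 v T, steiner 2 T & homogeneous 3 T])
  <-> ~~ [|| 10 <= v <= 15, 19 <= v <= 23, 28 <= v <= 31, 37 <= v <= 39
           | v \in [:: 46; 47; 55]].
Proof.
split=> [[T [[_ _ T3 Td Tb] Ts Th]]|/(semigroup89P hv)[a [b vab]]]; last first.
  have [|T [TA Td Tb Ts Th]] := @trade_on_exists V a b setT.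
    by rewrite cardsT hV.
  have {}Th x i : #|[set B in T i | x \in B]| = 3 by apply: Th; rewrite inE.
  have T3 i B : B \in T i -> #|B| = 3 by case/TA.
  exists T; split; [split=> // [|i]|by move=> S S2 _; apply: Ts|by []].
    by split=> //; rewrite hV; apply: leq_trans hv.
  (* Three points per block and three blocks per point force as many blocks as points. *)
  have := sum_card_blocks (T i) setT.
  under eq_bigr => B /T3 B3 do rewrite setIT B3.
  under [RHS]eq_bigr => x _ do rewrite Th.
  by rewrite !sum_nat_const cardsT hV => /eqP; rewrite eqn_mul2r => /eqP.
apply/(semigroup89P hv).
(* A pair inside some block lies in the foundation; any other pair is covered 0 times. *)
have pair_le1 (S : {set V}) i : #|S| = 2 -> #|[set B in T i | S \subset B]| <= 1.
  move=> S2; have [->|[B]] := set_0Vmem [set B in T i | S \subset B].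
    by rewrite cards0.
  rewrite inE => /andP[BT SB]; apply: Ts => //; apply: subset_trans SB _.
  by apply: (bigcup_max i) => //; apply: (bigcup_max B).
pose U (i : nat) := T (inord i).
have cardU i B : i < 3 -> B \in U i -> #|B| = 3 by move=> _; apply: T3.
rewrite -hV -cardsT; apply: (@card_closed_set V U) => //.
- move=> i j B i3 j3 BT; apply: contraTeq => ij.
  rewrite (disjointFr (Td _ _ _) BT) //.
  by apply: contra ij => /eqP/(congr1 (@nat_of_ord 3)); rewrite !inordK // => ->.
(* If the intersection were a pair, the Steiner bound would give [B = C], of size 3. *)
- move=> i B C i3 BT CT; apply/eqP=> BC2.
  have /card_le1_eqP BC := pair_le1 _ (inord i) BC2.
  have EBC : B = C by apply: BC; rewrite inE ?BT ?CT ?subsetIl ?subsetIr.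
  by move: BC2; rewrite EBC setIid (cardU i).
- move=> i j B x y i3 j3 xy BT xB yB.
  have : 0 < #|[set C in U j | [set x; y] \subset C]|.
    rewrite (Tb _ _ _ (inord i)) ?cards2 ?xy //.
    by apply/card_gt0P; exists B; rewrite inE BT subUset !sub1set xB.
  case/card_gt0P=> C; rewrite inE subUset !sub1set => /andP[CT xyC].
  by exists C.
(* The three blocks of collection 0 through [x] have two further points each. By the Steiner bound
   every other point lies in at most one of them, so the sum 6 counts the neighbours. *)
- move=> x; have := sum_card_blocks [set B in U 0 | x \in B] [set~ x].
  have -> : \sum_(B in [set B in U 0 | x \in B]) #|B :&: [set~ x]| = 6.
    transitivity (\sum_(B in [set B in U 0 | x \in B]) 2).
      apply: eq_bigr => B; rewrite inE => /andP[BT xB].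
      by move: (T3 _ _ BT); rewrite (cardsD1 x) xB setDE => -[].
    by rewrite sum_nat_const Th.
  move=> ->; rewrite -sum1_card big_mkcond [RHS]big_mkcond /=.
  apply: eq_bigr => y _; rewrite !inE; case: eqP => //= /eqP yx.
  set F := [set B in _ | _].
  have F1 : #|F| <= 1.
    suff -> : F = [set B in U 0 | [set x; y] \subset B].
      by apply: pair_le1; rewrite cards2 eq_sym yx.
    by apply/setP=> B; rewrite !inE subUset !sub1set andbA.
  case: existsP => [[B /and3P[BT xB yB]]|nB].
    apply/esym/eqP; rewrite eqn_leq F1; apply/card_gt0P.
    by exists B; rewrite !inE BT xB.
  apply/esym/eqP; rewrite cards_eq0 -subset0; apply/subsetP=> B.
  by rewrite !inE -andbA => ?; case: nB; exists B.
Qed.
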